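(* Let $R$ be a noetherian ring and let $n$ be a non-negative integer. Then the following hold. (1) Let $\mathfrak q$ be a prime ideal of $R[t_1, \ldots, t_n]$. Then $\mathfrak q \cap U_{R[t_1,\ldots,t_n]/R} = \emptyset$ if and only if $\mathfrak q \subset \mathfrak m R[t_1,\ldots,t_n]$ for some maximal ideal $\mathfrak m$ of $R$. (2) For any maximal ideal $\mathfrak m$ of $R$, $\mathfrak m R(t_1,\ldots,t_n)$ is a maximal ideal of $R(t_1,\ldots,t_n)$. (3) Let $\epsilon : R \to R(t_1,\ldots,t_n)$ be the induced ring homomorphism. Then $\mathfrak n \mapsto \epsilon^{-1}(\mathfrak n)$ defines a bijection from the set of maximal ideals of $R(t_1,\ldots,t_n)$ to the set of maximal ideals of $R$, whose inverse map is given by $\mathfrak m \mapsto \mathfrak m R(t_1,\ldots,t_n)$.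
   Context: For a ring $R$, $R[t_1,\ldots,t_n]$ is the polynomial ring, $$U_{R[t_1,\ldots,t_n]/R} := \bigcap_{\mathfrak p \in \operatorname{Spec} R} \bigl(R[t_1,\ldots,t_n] \setminus \mathfrak p R[t_1,\ldots,t_n]\bigr) = \bigcap_{\mathfrak m \text{ maximal}} \bigl(R[t_1,\ldots,t_n] \setminus \mathfrak m R[t_1,\ldots,t_n]\bigr),$$ a multiplicatively closed subset, and $R(t_1,\ldots,t_n) := U_{R[t_1,\ldots,t_n]/R}^{-1} R[t_1,\ldots,t_n]$. *)

(* Defs.v *)
From HB Require Import structures.
From mathcomp Require Import all_boot all_order all_algebra.
From mathcomp Require Import ring.
From mathcomp Require Import boolp classical_sets functions.
From mathcomp Require Import mpoly.

Set Implicit Arguments.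
Unset Strict Implicit.
Unset Printing Implicit Defensive.

Import GRing.Theory.

Local Open Scope classical_set_scope.
Local Open Scope ring_scope.
Local Open Scope quotient_scope.

(* Ideals are Prop-valued sets, possibly improper, in rings that may be zero:
   ring_quotient.v only offers boolean proper ideals of nontrivial rings. *)
Section Ideals.
Variable A : comPzRingType.
Implicit Types I J : set A.

Definition is_ideal I : Prop :=
  [/\ I 0, forall x y, I x -> I y -> I (x + y) & forall a x, I x -> I (a * x)].

Definition prime_ideal I : Prop :=
  [/\ is_ideal I, ~ I 1 & forall x y, I (x * y) -> I x \/ I y].

Definition maximal_ideal I : Prop :=
  [/\ is_ideal I, ~ I 1 &
      forall J, is_ideal J -> ~ J 1 -> I `<=` J -> J = I].

Definition ideal_gen (X : set A) : set A := smallest is_ideal X.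

Definition noetherian : Prop :=
  forall I, is_ideal I -> exists s : seq A, I = ideal_gen [set` s].

Definition max_spec : set (set A) := [set I | maximal_ideal I].

Lemma ideal_gen_ideal (X : set A) : is_ideal (ideal_gen X).
Proof.
split=> [J [[]]//|x y xX yX J JX|a x xX J JX].
- by have [[_ JD _] _] := JX; apply: JD; [exact: xX | exact: yX].
- by have [[_ _ JM] _] := JX; apply: JM; exact: xX.
Qed.

Lemma ideal_sum I (T : Type) (r : seq T) (P : pred T) (F : T -> A) :
  is_ideal I -> (forall i, P i -> I (F i)) -> I (\sum_(i <- r | P i) F i).
Proof. by move=> [I0 ID _] IF; elim/big_ind: _. Qed.

End Ideals.

Arguments noetherian : clear implicits.
Arguments max_spec : clear implicits.

Definition ext_ideal (A B : comPzRingType) (f : {rmorphism A -> B})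
  (I : set A) : set B := ideal_gen (f @` I).

Record multset (A : comPzRingType) := MultSet {
  mset :> set A;
  mset1 : mset 1;
  msetM : forall x y, mset x -> mset y -> mset (x * y)
}.

Section Localization.
Variables (A : comPzRingType) (S : multset A).

Local Notation den := (set_type (mset S)).

(* The pair (a, s) stands for the fraction a / s. *)
Definition pre_frac : Type := (A * den)%type.
HB.instance Definition _ := Choice.on pre_frac.

Definition eq_frac (x y : pre_frac) : bool :=
  `[< exists2 u, mset S u &
        u * (x.1 * val y.2) = u * (y.1 * val x.2) >].

Lemma denP (s : den) : mset S (val s).
Proof. exact: set_mem (valP s). Qed.

Lemma eq_frac_equiv : equiv_class_of eq_frac.
Proof.
split=> [x|x y|y x z].
- by apply/asboolP; exists 1 => //; apply: mset1.
- by apply/asboolP/asboolP => -[u Su e]; exists u.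
move=> /asboolP[u Su e1] /asboolP[v Sv e2]; apply/asboolP.
exists (u * v * val y.2); first by do !apply: msetM => //; exact: denP.
transitivity (v * val z.2 * (u * (x.1 * val y.2))); first by ring.
rewrite e1.
transitivity (u * val x.2 * (v * (y.1 * val z.2))); first by ring.
by rewrite e2; ring.
Qed.

Canonical eq_frac_equivRel := EquivRelPack eq_frac_equiv.
Canonical eq_frac_encModRel := defaultEncModRel eq_frac.

Definition loc : Type := {eq_quot eq_frac}.
HB.instance Definition _ : EqQuotient pre_frac eq_frac loc :=
  EqQuotient.on loc.
HB.instance Definition _ := Choice.on loc.

Definition den1 : den := exist _ 1 (mem_set (@mset1 _ S)).
Definition denM (s t : den) : den :=
  exist _ (val s * val t) (mem_set (msetM (denP s) (denP t))).

Lemma val_den1 : val den1 = 1. Proof. by []. Qed.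
Lemma val_denM s t : val (denM s t) = val s * val t. Proof. by []. Qed.

Definition frac (a : A) (s : den) : loc := \pi_loc ((a, s) : pre_frac).

Lemma frac_eqP a s b t : frac a s = frac b t <->
  exists2 u, mset S u & u * (a * val t) = u * (b * val s).
Proof.
by split=> [/eqmodP/asboolP//|h]; apply/eqmodP/asboolP.
Qed.

Lemma frac_repr (x : loc) : frac (repr x).1 (repr x).2 = x.
Proof. by rewrite /frac -surjective_pairing reprK. Qed.

Lemma fracP (x : loc) : exists a s, x = frac a s.
Proof. by exists (repr x).1, (repr x).2; rewrite frac_repr. Qed.

Definition loc_opp (x : loc) : loc := frac (- (repr x).1) (repr x).2.
Definition loc_add (x y : loc) : loc :=
  frac ((repr x).1 * val (repr y).2 + (repr y).1 * val (repr x).2)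
       (denM (repr x).2 (repr y).2).
Definition loc_mul (x y : loc) : loc :=
  frac ((repr x).1 * (repr y).1) (denM (repr x).2 (repr y).2).

Lemma loc_oppE a s : loc_opp (frac a s) = frac (- a) s.
Proof.
rewrite /loc_opp; move: (repr _).1 (repr _).2 (frac_repr (frac a s)) => b t.
move=> /frac_eqP[u Su e]; apply/frac_eqP; exists u => //.
by rewrite !mulNr !mulrN e.
Qed.

Lemma loc_addE a s b t :
  loc_add (frac a s) (frac b t) = frac (a * val t + b * val s) (denM s t).
Proof.
rewrite /loc_add.
move: (repr _).1 (repr _).2 (frac_repr (frac a s)) => a' s' /frac_eqP[u Su eu].
move: (repr _).1 (repr _).2 (frac_repr (frac b t)) => b' t' /frac_eqP[v Sv ev].
apply/frac_eqP; exists (u * v); first exact: msetM.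
rewrite !val_denM.
transitivity (v * val t * val t' * (u * (a' * val s))
            + u * val s * val s' * (v * (b' * val t))); first by ring.
by rewrite eu ev; ring.
Qed.

Lemma loc_mulE a s b t :
  loc_mul (frac a s) (frac b t) = frac (a * b) (denM s t).
Proof.
rewrite /loc_mul.
move: (repr _).1 (repr _).2 (frac_repr (frac a s)) => a' s' /frac_eqP[u Su eu].
move: (repr _).1 (repr _).2 (frac_repr (frac b t)) => b' t' /frac_eqP[v Sv ev].
apply/frac_eqP; exists (u * v); first exact: msetM.
rewrite !val_denM.
transitivity ((u * (a' * val s)) * (v * (b' * val t))); first by ring.
by rewrite eu ev; ring.
Qed.

Lemma frac_eq a s b t : a * val t = b * val s -> frac a s = frac b t.
Proof. by move=> e; apply/frac_eqP; exists 1; [exact: mset1 | rewrite e]. Qed.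

Local Ltac frac_ring :=
  by apply: frac_eq; rewrite ?(val_denM, val_den1); ring.

Lemma loc_addA : associative loc_add.
Proof.
move=> x y z; have [a [s ->]] := fracP x; have [b [t ->]] := fracP y.
by have [c [r ->]] := fracP z; rewrite !loc_addE; frac_ring.
Qed.

Lemma loc_addC : commutative loc_add.
Proof.
move=> x y; have [a [s ->]] := fracP x; have [b [t ->]] := fracP y.
by rewrite !loc_addE; frac_ring.
Qed.

Lemma loc_add0 : left_id (frac 0 den1) loc_add.
Proof.
move=> x; have [a [s ->]] := fracP x.
by rewrite loc_addE; frac_ring.
Qed.

Lemma loc_addN : left_inverse (frac 0 den1) loc_opp loc_add.
Proof.
move=> x; have [a [s ->]] := fracP x.
by rewrite loc_oppE loc_addE; frac_ring.
Qed.

HB.instance Definition _ :=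
  GRing.isZmodule.Build loc loc_addA loc_addC loc_add0 loc_addN.

Lemma loc_mulA : associative loc_mul.
Proof.
move=> x y z; have [a [s ->]] := fracP x; have [b [t ->]] := fracP y.
by have [c [r ->]] := fracP z; rewrite !loc_mulE; frac_ring.
Qed.

Lemma loc_mulC : commutative loc_mul.
Proof.
move=> x y; have [a [s ->]] := fracP x; have [b [t ->]] := fracP y.
by rewrite !loc_mulE; frac_ring.
Qed.

Lemma loc_mul1 : left_id (frac 1 den1) loc_mul.
Proof.
move=> x; have [a [s ->]] := fracP x.
by rewrite loc_mulE; frac_ring.
Qed.

Lemma loc_mulDl : left_distributive loc_mul loc_add.
Proof.
move=> x y z; have [a [s ->]] := fracP x; have [b [t ->]] := fracP y.
have [c [r ->]] := fracP z; rewrite !(loc_mulE, loc_addE).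
by frac_ring.
Qed.

HB.instance Definition _ :=
  GRing.Zmodule_isComPzRing.Build loc loc_mulA loc_mulC loc_mul1 loc_mulDl.

Lemma fracN a s : - frac a s = frac (- a) s.
Proof. exact: loc_oppE. Qed.

Lemma fracD a s b t :
  frac a s + frac b t = frac (a * val t + b * val s) (denM s t).
Proof. exact: loc_addE. Qed.

Lemma fracM a s b t : frac a s * frac b t = frac (a * b) (denM s t).
Proof. exact: loc_mulE. Qed.

Definition to_loc (a : A) : loc := frac a den1.

Lemma to_loc_is_zmod_morphism : zmod_morphism to_loc.
Proof.
move=> a b; rewrite /to_loc fracN fracD.
by frac_ring.
Qed.

Lemma to_loc_is_monoid_morphism : monoid_morphism to_loc.
Proof.
split=> // a b; rewrite /to_loc fracM.
by frac_ring.
Qed.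

HB.instance Definition _ :=
  GRing.isZmodMorphism.Build A loc to_loc to_loc_is_zmod_morphism.
HB.instance Definition _ :=
  GRing.isMonoidMorphism.Build A loc to_loc to_loc_is_monoid_morphism.

End Localization.

Section NagataRing.
Variables (R : comNzRingType) (n : nat).
Implicit Types (p : set R) (f g : {mpoly R[n]}).

Definition U_set : set {mpoly R[n]} :=
  \bigcap_(p in [set p : set R | prime_ideal p])
    ~` ext_ideal (@mpolyC n R) p.

Lemma mem_ext_mpolyC p f : is_ideal p ->
  ext_ideal (@mpolyC n R) p f <-> forall m, p f@_m.
Proof.
move=> pI; have [p0 pD pM] := pI; split=> [|pf].
  move/(_ [set g | forall m, p g@_m]); apply.
  split; last by move=> _ [a pa <-] m; rewrite mcoeffC mulrC; exact: pM.
  split=> [m|g h pg ph m|g h ph m]; first by rewrite mcoeff0.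
    by rewrite mcoeffD; exact: pD.
  by rewrite mcoeffM; apply: ideal_sum => // k _; exact: pM.
rewrite [f]mpolyE; apply: ideal_sum => [|m _]; first exact: ideal_gen_ideal.
rewrite -mul_mpolyC mulrC; have [_ _ M] := ideal_gen_ideal (@mpolyC n R @` p).
by apply: M => J [_]; apply; exists f@_m.
Qed.

Lemma U_set1 : U_set 1.
Proof.
move=> p [pI p1 _] /(mem_ext_mpolyC _ pI)/(_ 0%MM).
by rewrite mcoeff1 eqxx.
Qed.

(* Drop from f the terms with coefficient in p, which changes f by an element
   of pR[t]; the leading coefficient is then outside p. *)
Lemma ext_mpolyC_trunc p f : is_ideal p -> ~ ext_ideal (@mpolyC n R) p f ->
  exists2 g, ext_ideal (@mpolyC n R) p (f - g) & ~ p (mleadc g).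
Proof.
move=> pI nf; have [p0 pD pM] := pI.
pose g := \sum_(m <- msupp f | ~~ `[< p f@_m >]) f@_m *: 'X_[m].
have gE m : g@_m = if `[< p f@_m >] then 0 else f@_m.
  rewrite /g raddf_sum /=.
  under eq_bigr do rewrite mcoeffZ mcoeffX.
  case: ifPn => [pm|npm].
    rewrite big1 // => k npk; case: eqP => [km|_]; last by rewrite mulr0.
    by rewrite km pm in npk.
  have mf : m \in msupp f.
    by rewrite mcoeff_msupp; apply: contra npm => /eqP ->; apply/asboolP.
  rewrite big_mkcond (bigD1_seq m) ?msupp_uniq //= npm eqxx mulr1.
  by rewrite big1 ?addr0 // => k /negPf ->; rewrite mulr0 if_same.
have fg : ext_ideal (@mpolyC n R) p (f - g).
  apply/mem_ext_mpolyC => // m; rewrite mcoeffB gE.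
  by case: asboolP; rewrite ?subr0 ?subrr.
exists g => // pg; have : g == 0.
  by rewrite -mleadc_eq0; move: pg; rewrite gE; case: asboolP.
by move/eqP=> g0; apply: nf; rewrite g0 subr0 in fg.
Qed.

Lemma U_setM f g : U_set f -> U_set g -> U_set (f * g).
Proof.
move=> Uf Ug p pp; have [pI p1 pP] := pp => fg.
have [f' ff' nf'] := ext_mpolyC_trunc pI (Uf p pp).
have [g' gg' ng'] := ext_mpolyC_trunc pI (Ug p pp).
have [_ D M] := ideal_gen_ideal (@mpolyC n R @` p).
have : ext_ideal (@mpolyC n R) p (f' * g').
  have -> : f' * g' = f * g + (-f * (g - g') + - g' * (f - f')) by ring.
  by do 2?[apply: (D) => //]; apply: (M).
move=> /(mem_ext_mpolyC _ pI)/(_ (mlead f' + mlead g')%MM).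
by rewrite mleadcM => /pP[].
Qed.

Definition U_mset : multset {mpoly R[n]} := MultSet U_set1 U_setM.

Definition nagata : comPzRingType := loc U_mset.

Definition eps : {rmorphism R -> nagata} := @to_loc _ U_mset \o @mpolyC n R.

End NagataRing.

Arguments U_set : clear implicits.
Arguments eps : clear implicits.

(* Main.v *)
Require Import Defs.
From mathcomp Require Import all_boot all_order all_algebra.
From mathcomp Require Import ring.
From mathcomp Require Import boolp classical_sets functions.
From mathcomp Require Import mpoly.

(** Call content of a polynomial [f] the ideal of [R] generated by its
    coefficients.  By [mem_ext_mpolyC], [f] lies in [pR[t]] exactly when its
    content lies in [p], so a polynomial of content [R] belongs to [U].

    Everything follows from one fact ([ideal_disjoint_U]): an ideal [I] of
    [R[t]] that misses [U] is contained in [mR[t]] for some maximal ideal [m]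
    of [R].  Given [f, g] in [I], some [h] in [I] has a content containing
    those of [f] and [g]: take [h = f + X^k g] with [X^k] of degree larger than
    that of [f], so that the terms of [f] and of [X^k g] do not collide.  Hence
    the union of the contents of the elements of [I] is an ideal of [R].  It is
    proper because no element of [I] has content [R], and any maximal ideal [m]
    above it works.  Conversely [mR[t]] misses [U], since [m] is prime; this is
    (1).

    An ideal [J] of [R(t)] is determined by its contraction to [R[t]], which
    misses [U] when [J] is proper; so [J] is contained in [mR(t)] for some
    maximal [m] ([proper_sub_ext_eps]).  The ideals [mR(t)] are therefore the
    only candidates for maximal ideals of [R(t)].  Each of them is maximal: a
    proper [J] containing [mR(t)] lies in some [m'R(t)]; contracting to [R]
    gives that [m] is contained in [m'], so [m = m'] and [J = mR(t)].  This is
    (2), and (3) follows because [mR(t)] contracts to [m]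
    ([preimage_ext_eps]). *)

Import GRing.Theory.

Local Open Scope classical_set_scope.
Local Open Scope ring_scope.

(** * Ideals, extension and contraction *)

Section IdealTheory.
Context {A : comPzRingType}.
Implicit Types I J : set A.

Lemma idealN {I} x : is_ideal I -> I x -> I (- x).
Proof. by move=> [_ _ IM] Ix; rewrite -mulN1r; exact: IM. Qed.

Lemma idealB {I} x y : is_ideal I -> I x -> I y -> I (x - y).
Proof. by move=> II Ix Iy; have [_ ID _] := II; apply/ID/idealN. Qed.

Lemma ideal_gen_sub (X : set A) J :
  is_ideal J -> X `<=` J -> ideal_gen X `<=` J.
Proof. by move=> JI XJ x; apply; split. Qed.

Lemma sub_ideal_gen (X : set A) : X `<=` ideal_gen X.
Proof. by move=> x Xx J [_]; apply. Qed.

End IdealTheory.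

Section Extension.
Context {A B : comPzRingType}.
Implicit Types (I J : set A) (f : {rmorphism A -> B}).

Lemma preimage_ideal f (J : set B) : is_ideal J -> is_ideal (f @^-1` J).
Proof.
move=> [J0 JD JM]; split=> [|x y|a x] /=; first by rewrite rmorph0.
  by rewrite rmorphD; exact: JD.
by rewrite rmorphM; exact: JM.
Qed.

Lemma ext_ideal_sub f I (J : set B) :
  is_ideal J -> I `<=` f @^-1` J -> ext_ideal f I `<=` J.
Proof. by move=> JI IJ; apply: (ideal_gen_sub _ _ JI) => _ [x Ix <-]; exact: IJ. Qed.

Lemma sub_ext_ideal f I : I `<=` f @^-1` (ext_ideal f I).
Proof. by move=> x Ix J [_]; apply; exists x. Qed.

End Extension.

Lemma ext_ideal_comp {A B C : comPzRingType} (f : {rmorphism A -> B})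
    (g : {rmorphism B -> C}) (h : {rmorphism A -> C}) (I : set A) :
  h =1 g \o f -> ext_ideal h I = ext_ideal g (ext_ideal f I).
Proof.
move=> hE; apply/seteqP; split; apply: ext_ideal_sub.
- exact: ideal_gen_ideal.
- by move=> x Ix /=; rewrite hE; do 2?apply: sub_ext_ideal.
- exact: ideal_gen_ideal.
apply: ext_ideal_sub; first by apply: preimage_ideal; exact: ideal_gen_ideal.
by move=> x /sub_ext_ideal -/(_ _ h) /=; rewrite hE.
Qed.

Section MaximalIdeals.
Context {A : comPzRingType}.
Implicit Types I m : set A.

Lemma maximal_ideal_eq {m1 m2 : set A} :
  maximal_ideal m1 -> maximal_ideal m2 -> m1 `<=` m2 -> m1 = m2.
Proof. by move=> [_ _ max1] [I2 p2 _] m12; rewrite (max1 m2). Qed.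

Lemma maximal_prime_ideal m : maximal_ideal m -> prime_ideal m.
Proof.
move=> [mI m1 mmax]; have [m0 mD mM] := mI; split=> // x y mxy.
have [mx|nmx] := pselect (m x); [by left | right].
(* J = m + xA is m or contains 1 *)
pose J : set A := [set a | exists r, m (a - r * x)].
have JI : is_ideal J.
  split=> [|a b [r ar] [s bs]|c a [r ar]].
  - by exists 0; rewrite mul0r subr0.
  - exists (r + s).
    by have -> : a + b - (r + s) * x = a - r * x + (b - s * x);
      [ring | exact: mD].
  by exists (c * r); rewrite -mulrA -mulrBr; exact: mM.
have mJ : m `<=` J by move=> a ma; exists 0; rewrite mul0r subr0.
have [[r r1]|nJ1] := pselect (J 1).
  have -> : y = y * (1 - r * x) + r * (x * y) by ring.
  by apply: mD; exact: mM.
by case: nmx; rewrite -(mmax _ JI nJ1 mJ); exists 1; rewrite mul1r subrr.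
Qed.

(** Krull: Zorn's lemma is applied to the sets [X] such that [I `|` X], rather
    than [X] itself, is a proper ideal; the union of the empty chain then needs
    no separate treatment. *)
Lemma sub_maximal_ideal I : is_ideal I -> ~ I 1 ->
  exists2 m, maximal_ideal m & I `<=` m.
Proof.
move=> II I1.
pose P : set (set A) := [set X | is_ideal (I `|` X) /\ ~ (I `|` X) 1].
have [F FP Ftot|M [[MI M1] Mmax]] := @Zorn_bigcup A P.
  have inI x X : X = set0 \/ F X -> (I `|` X) x ->
      (I `|` \bigcup_(X in F) X) x.
    by move=> [->|FX] [Ix|Xx]; [left|case: Xx|left|right; exists X].
  have memU x : (I `|` \bigcup_(X in F) X) x ->
      exists2 X, X = set0 \/ F X & (I `|` X) x.
    move=> [Ix|[X FX Xx]]; first by exists set0; [left | left].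
    by exists X; right.
  have P0 X : X = set0 \/ F X -> P X.
    by move=> [->|/FP //]; split; rewrite setU0.
  have tot X Y : X = set0 \/ F X -> Y = set0 \/ F Y -> X `<=` Y \/ Y `<=` X.
    by move=> [->|FX] [->|FY]; [left|left|right|exact: Ftot]; exact: sub0set.
  split; last by move=> /memU[X /P0[_ PX1]].
  split=> [|x y /memU[X FX Xx] /memU[Y FY Yy]|a x /memU[X FX Xx]].
  - by left; have [] := II.
  - have [XY|YX] := tot _ _ FX FY.
      apply: (inI _ Y) => //; have [[_ YD _] _] := P0 _ FY; apply: YD => //.
      by apply: setUS Xx.
    apply: (inI _ X) => //; have [[_ XD _] _] := P0 _ FX; apply: XD => //.
    by apply: setUS Yy.
  by apply: (inI _ X) => //; have [[_ _ XM] _] := P0 _ FX; exact: XM.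
exists (I `|` M); last exact: subsetUl.
split=> // J JI J1 IMJ; apply: contrapT => neqJ.
have MJ : M `<=` J by apply: subset_trans IMJ; exact: subsetUr.
have IJ : I `<=` J by apply: subset_trans IMJ; exact: subsetUl.
apply: (Mmax J); last by split; rewrite ((setUidPr _ _).2 IJ).
split=> // JM; apply: neqJ; apply/seteqP; split=> // x /JM; by right.
Qed.

End MaximalIdeals.

(** * Ideals of a localization *)

Local Notation frac := Defs.frac.

Section LocalizationIdeals.
Context {A : comPzRingType} (S : multset A).
Local Notation iota := (@to_loc A S : {rmorphism A -> loc S}).

Lemma frac_to_loc a (s : set_type (mset S)) :
  frac a s = frac 1 s * iota a.
Proof.
by rewrite /= /to_loc fracM; apply: frac_eq; rewrite val_denM val_den1; ring.
Qed.

Lemma to_loc_frac a (s : set_type (mset S)) :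
  iota a = iota (val s) * frac a s.
Proof.
by rewrite /= /to_loc fracM; apply: frac_eq; rewrite val_denM val_den1 mul1r mulr1 mulrC.
Qed.

(** A fraction and its numerator differ by a unit, so an ideal of the
    localization is determined by its contraction. *)
Lemma loc_ideal_sub (J K : set (loc S)) : is_ideal J -> is_ideal K ->
  iota @^-1` J `<=` iota @^-1` K -> J `<=` K.
Proof.
move=> [_ _ JM] [_ _ KM] JK x; have [a [s ->]] := fracP x => Jx.
by rewrite frac_to_loc; apply/KM/JK; rewrite /preimage /= (to_loc_frac a s);
  exact: JM.
Qed.

Lemma preimage_loc_disjoint (J : set (loc S)) : is_ideal J -> ~ J 1 ->
  iota @^-1` J `&` S = set0.
Proof.
move=> [_ _ JM] J1; apply/seteqP; split=> // s [Js Ss]; apply: J1.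
pose s' : set_type (mset S) := exist _ s (mem_set Ss).
have -> : 1 = frac 1 s' * iota s; last exact: JM.
by rewrite -frac_to_loc; apply: frac_eq; rewrite val_den1 mulrC.
Qed.

Lemma ext_to_loc_frac (I : set A) x : is_ideal I ->
  ext_ideal iota I x -> exists a s, I a /\ x = frac a s.
Proof.
move=> [I0 ID IM]; apply: (ext_ideal_sub _ _ [set x | _]) => [|a Ia]; last first.
  by exists a, (den1 S).
split=> [|_ _ [a [s [Ia ->]]] [b [t [Ib ->]]]|y _ [a [s [Ia ->]]]].
- by exists 0, (den1 S).
- exists (a * val t + b * val s), (denM s t); split; last exact: fracD.
  by apply: ID; rewrite mulrC; exact: IM.
have [b [t ->]] := fracP y; exists (b * a), (denM t s).
by split; [exact: IM | exact: fracM].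
Qed.

Lemma ext_to_loc_proper (I : set A) : is_ideal I -> I `&` S = set0 ->
  ~ ext_ideal iota I 1.
Proof.
move=> II IS /(ext_to_loc_frac _ _ II)[a [s [Ia /frac_eqP[u Su]]]].
rewrite val_den1 mul1r mulr1 => e.
suff : (I `&` S) (u * val s) by rewrite IS.
split; last by apply: msetM => //; exact: denP.
by rewrite e; have [_ _ IM] := II; exact: IM.
Qed.

End LocalizationIdeals.

(** * Contents of polynomials *)

Section Content.
Context {R : comNzRingType} {n : nat}.
Implicit Types (f g : {mpoly R[n]}) (I : set {mpoly R[n]}).

Definition content f : set R := ideal_gen [set f@_k | k in setT].

Lemma content_ideal f : is_ideal (content f).
Proof. exact: ideal_gen_ideal. Qed.

Lemma coeff_content f k : content f f@_k.
Proof. by apply: sub_ideal_gen; exists k. Qed.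

Lemma content_sub f (J : set R) :
  is_ideal J -> (forall k, J f@_k) -> content f `<=` J.
Proof. by move=> JI fJ; apply: ideal_gen_sub => // _ [k _ <-]. Qed.

Lemma content1_U f : content f 1 -> U_set R n f.
Proof.
move=> f1 p [pI p1 _] /(mem_ext_mpolyC _ pI) fp.
exact/p1/(content_sub f p).
Qed.

(** Without variables there is no room to shift [g] away from [f]; but then
    every polynomial is a constant, and its content consists of its
    multiples. *)
Lemma content_const I f c : n = 0%N -> is_ideal I -> I f -> content f c ->
  I c%:MP.
Proof.
move=> n0 II If; apply: (content_sub f (@mpolyC n R @^-1` I)).
  exact: (preimage_ideal (@mpolyC n R)).
move=> k; suff fk : (f@_k)%:MP_[n] = f by rewrite /preimage /= fk.
apply/mpolyP => l; have -> : l = k.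
  by apply/mnmP => i; have := ltn_ord i; rewrite {2}n0.
rewrite mcoeffC; suff -> : k = 0%MM by rewrite eqxx mulr1.
by apply/mnmP => i; have := ltn_ord i; rewrite {2}n0.
Qed.

(** For [n > 0] the witness is [f + X^k g] with the degree of [X^k] at least
    [msize f].  Its content contains the coefficients of [g], read off at the
    exponents [k + m] where [f] vanishes, and hence also those of [f], by
    difference. *)
Lemma mem_content_add I f g a b : is_ideal I -> I f -> I g ->
  content f a -> content g b -> exists2 h, I h & content h (a + b).
Proof.
move=> II If Ig fa gb; have [I0 ID IM] := II.
have [n0|n0] := posnP n.
  exists (a + b)%:MP.
    by rewrite mpolyCD; apply: ID; [move: fa | move: gb]; exact: content_const.
  by have := coeff_content (a + b)%:MP 0%MM; rewrite mcoeffC eqxx mulr1.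
pose k : 'X_{1..n} := (U_(Ordinal n0) *+ msize f)%MM.
have kf m : f@_(k + m) = 0.
  by apply/memN_msupp_eq0/msize_mdeg_ge; rewrite mdegD mdegMn mdeg1 mul1n
    leq_addr.
pose h := f + g * 'X_[k].
have [h0 hD hM] := content_ideal h.
have gh : content g `<=` content h.
  apply: (content_sub _ (content h)) => // m.
  have -> : g@_m = h@_(k + m) by rewrite mcoeffD kf add0r mcoeffMX.
  exact: coeff_content.
have fh : content f `<=` content h.
  apply: (content_sub _ (content h)) => // m.
  have -> : f@_m = h@_m - (g * 'X_[k])@_m by rewrite mcoeffD addrK.
  apply: (idealB _ _ (content_ideal h)); first exact: coeff_content.
  apply: (gh); rewrite mcoeffM; apply: ideal_sum; first exact: content_ideal.
  move=> j _; rewrite mulrC; have [_ _ gM] := content_ideal g.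
  by apply: (gM); exact: coeff_content.
exists h; first by apply: ID => //; rewrite mulrC; exact: IM.
by apply: (hD); [exact: fh | exact: gh].
Qed.

(** Here [C], the union of the contents of the elements of [I], is an ideal by
    [mem_content_add]; it is proper because [I] misses [U]. *)
Lemma ideal_disjoint_U I : is_ideal I -> I `&` U_set R n = set0 ->
  exists2 m, maximal_ideal m & I `<=` ext_ideal (@mpolyC n R) m.
Proof.
move=> II IU; have [I0 ID IM] := II.
pose C : set R := \bigcup_(f in I) content f.
have CI : is_ideal C.
  split=> [|a b [f If fa] [g Ig gb]|a b [f If fb]].
  - by exists 0 => //; have [] := content_ideal 0.
  - by have [h] := mem_content_add _ _ _ _ _ II If Ig fa gb; exists h.
  by exists f => //; have [_ _ fM] := content_ideal f; exact: fM.
have C1 : ~ C 1.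
  by move=> [f If /content1_U fU]; suff : (I `&` U_set R n) f by rewrite IU.
have [m mmax Cm] := sub_maximal_ideal _ CI C1.
exists m => // f If; have [mI _ _] := mmax; apply/mem_ext_mpolyC => // k.
by apply: Cm; exists f => //; exact: coeff_content.
Qed.

Lemma ext_mpolyC_disjoint (p : set R) : prime_ideal p ->
  ext_ideal (@mpolyC n R) p `&` U_set R n = set0.
Proof. by move=> pP; apply/seteqP; split=> // f [pf /(_ p pP)]. Qed.

End Content.

(** * Maximal ideals of the Nagata ring *)

Section NagataMaximal.
Context {R : comNzRingType} {n : nat}.
Implicit Types (m : set R) (J N : set (nagata R n)).
Local Notation iota :=
  (@to_loc _ (U_mset R n) : {rmorphism {mpoly R[n]} -> nagata R n}).

Lemma ext_epsE m :
  ext_ideal (eps R n) m = ext_ideal iota (ext_ideal (@mpolyC n R) m).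
Proof. exact: ext_ideal_comp. Qed.

Lemma ext_eps_proper m : maximal_ideal m -> ~ ext_ideal (eps R n) m 1.
Proof.
move=> /maximal_prime_ideal mP; rewrite ext_epsE.
apply: ext_to_loc_proper; first exact: ideal_gen_ideal.
exact: ext_mpolyC_disjoint.
Qed.

Lemma preimage_ext_eps m : maximal_ideal m ->
  eps R n @^-1` (ext_ideal (eps R n) m) = m.
Proof.
move=> mmax; have [_ _ maxP] := mmax; apply: maxP.
- by apply: preimage_ideal; exact: ideal_gen_ideal.
- by rewrite /preimage /= rmorph1; exact: ext_eps_proper.
exact: sub_ext_ideal.
Qed.

Lemma proper_sub_ext_eps J : is_ideal J -> ~ J 1 ->
  exists2 m, maximal_ideal m & J `<=` ext_ideal (eps R n) m.
Proof.
move=> JI J1.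
have [m mmax sub] := ideal_disjoint_U _ (preimage_ideal iota _ JI)
  (preimage_loc_disjoint _ _ JI J1).
exists m => //; rewrite ext_epsE; apply: loc_ideal_sub => //.
  exact: ideal_gen_ideal.
by apply: subset_trans sub _; exact: sub_ext_ideal.
Qed.

(** A proper ideal above [mR(t)] lies below some [m'R(t)], and contracting
    both to [R] forces [m = m']. *)
Lemma ext_eps_maximal m : maximal_ideal m ->
  maximal_ideal (ext_ideal (eps R n) m).
Proof.
move=> mmax; split=> [||J JI J1 mJ].
- exact: ideal_gen_ideal.
- exact: ext_eps_proper.
have [m' m'max Jm'] := proper_sub_ext_eps J JI J1.
suff mm' : m = m' by apply/seteqP; split=> //; rewrite mm'.
apply: maximal_ideal_eq => //; rewrite -(preimage_ext_eps m' m'max).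
apply: subset_trans (sub_ext_ideal (eps R n) m) _.
exact: (preimage_subset (subset_trans mJ Jm')).
Qed.

Lemma maximal_ext_eps N : maximal_ideal N ->
  exists2 m, maximal_ideal m & N = ext_ideal (eps R n) m.
Proof.
move=> Nmax; have [NI N1 _] := Nmax.
have [m mmax Nm] := proper_sub_ext_eps N NI N1; exists m => //.
by apply: maximal_ideal_eq => //; exact: ext_eps_maximal.
Qed.

End NagataMaximal.

Theorem theorem3p7 (R : comNzRingType) (n : nat) (noethR : noetherian R) :
  [/\ (* (1) *)
      forall q : set {mpoly R[n]}, prime_ideal q ->
        (q `&` U_set R n = set0 <->
         exists2 m : set R, maximal_ideal m & q `<=` ext_ideal (@mpolyC n R) m),
      (* (2) *)
      forall m : set R, maximal_ideal m -> maximal_ideal (ext_ideal (eps R n) m)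
    & (* (3) *)
      [/\ set_bij (max_spec (nagata R n)) (max_spec R)
            (fun N : set (nagata R n) => eps R n @^-1` N),
          forall N : set (nagata R n), maximal_ideal N ->
            ext_ideal (eps R n) (eps R n @^-1` N) = N
        & forall m : set R, maximal_ideal m ->
            eps R n @^-1` (ext_ideal (eps R n) m) = m]].
Proof.
have extK (N : set (nagata R n)) : maximal_ideal N ->
    ext_ideal (eps R n) (eps R n @^-1` N) = N.
  by move=> /maximal_ext_eps[m mmax ->]; rewrite preimage_ext_eps.
split; [|exact: ext_eps_maximal|split=> //; [|exact: preimage_ext_eps]].
  move=> q [qI _ _]; split; first exact: ideal_disjoint_U.
  move=> [m /maximal_prime_ideal mP qm]; apply/seteqP; split=> // f [qf fU].
  by rewrite -(ext_mpolyC_disjoint m mP); split=> //; exact: qm.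
split.
- by move=> _ /maximal_ext_eps[m mmax ->] /=; rewrite preimage_ext_eps.
- move=> N N' /set_mem Nmax /set_mem N'max eqN.
  by rewrite -(extK N Nmax) eqN extK.
move=> m mmax; exists (ext_ideal (eps R n) m); first exact: ext_eps_maximal.
exact: preimage_ext_eps.
Qed.
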